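(* Let $X$ be a Cantor space and let $\mu\in M^0_\infty(X)$ be a good measure. Then the clopen values set $S(\mu)$ is group-like. Conversely, for every countable dense group-like subset $D$ of $[0,\infty)$ which contains $0$ there is a good non-defective measure $\mu$ on a Cantor space such that $S(\mu)=D$.
   Context: A Cantor space is a non-empty zero-dimensional compact perfect metric space. A Borel measure on a Cantor space $X$ is full if every non-empty open set has positive measure. $M_\infty(X)$ is the set of all full non-atomic Borel measures $\mu$ on $X$ with $\mu(X)=\infty$. For $\mu\in M_\infty(X)$ the defective set is $\mathfrak{M}_\mu=\{x\in X:\mu(U)=\infty\text{ for every clopen }U\ni x\}$. $\mu$ is non-defective if $\mu(\mathfrak{M}_\mu)=0$; the class of non-defective measures is $M^0_\infty(X)$. For $\mu\in M^0_\infty(X)$ the clopen values set is $S(\mu)=\{\mu(U): U\text{ clopen in }X,\ \mu(U)<\infty\}$. A measure $\mu\in M^0_\infty(X)$ is good if whenever $U,V$ are clopen subsets of $X$ with $\mu(U)<\mu(V)$, there is a clopen $W\subset V$ with $\mu(W)=\mu(U)$. A dense countable unbounded subset $D\subset[0,\infty)$ is group-like if for every $\gamma\in D$ there is an additive subgroup $G$ of $\mathbb{R}$ such that $D\cap[0,\gamma]=G\cap[0,\gamma]$. *)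

(* Defs.v *)
From HB Require Import structures.
From mathcomp Require Import all_boot all_order all_algebra.
From mathcomp Require Import all_classical all_reals all_analysis.

Set Implicit Arguments.
Unset Strict Implicit.
Unset Printing Implicit Defensive.

Import Order.TTheory GRing.Theory Num.Theory.
Import numFieldNormedType.Exports.

Local Open Scope classical_set_scope.
Local Open Scope ring_scope.

(* Non-emptiness of a Cantor space is carried by the pointed structure, which
   [g_sigma_algebraType] requires anyway. Nothing below depends on the choice
   of the base point. *)
#[short(type="pmetricType")]
HB.structure Definition PointedMetric (R : numDomainType) :=
  { T of Pointed T & Metric R T }.

Notation borelMeasure R X :=
  {measure set (g_sigma_algebraType (@open X)) -> \bar R}.

(* The library's [zero_dimensional], a conjunct of [cantor_like], separates
   points by clopen sets; on compact spaces this amounts to a clopen base. *)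
Definition cantor_metric_space (R : realType) (X : pmetricType R) : Prop :=
  cantor_like X.

Section infinite_measures.
Context {R : realType} {X : pmetricType R}.
Implicit Type mu : borelMeasure R X.

Local Open Scope ereal_scope.

Definition full_measure mu : Prop :=
  forall U : set X, open U -> U !=set0 -> 0 < mu U.

Definition non_atomic mu : Prop :=
  forall A : set (g_sigma_algebraType (@open X)), measurable A -> 0 < mu A ->
    exists B : set (g_sigma_algebraType (@open X)),
      [/\ measurable B, B `<=` A, 0 < mu B & mu B < mu A].

Definition M_infty mu : Prop :=
  [/\ full_measure mu, non_atomic mu & mu setT = +oo].

Definition defective_set mu : set X :=
  [set x | forall U : set X, clopen U -> U x -> mu U = +oo].

Definition M0_infty mu : Prop := M_infty mu /\ mu (defective_set mu) = 0.

(* [r : R], so only the finite values are collected. *)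
Definition clopen_values mu : set R :=
  [set r | exists2 U : set X, clopen U & mu U = r%:E].

(* The values of [mu] are extended reals: [V] may have infinite measure. *)
Definition good_measure mu : Prop :=
  forall U V : set X, clopen U -> clopen V -> mu U < mu V ->
    exists W : set X, [/\ clopen W, W `<=` V & mu W = mu U].

End infinite_measures.

Definition group_like (R : realType) (D : set R) : Prop :=
  [/\ D `<=` `[0, +oo[,
      countable D,
      `[0, +oo[ `<=` closure D,
      ~ has_ubound D &
      forall gamma, D gamma -> exists2 G : {pred R}, zmod_closed G &
        D `&` `[0, gamma] = [set` G] `&` `[0, gamma]].

(* Main.v *)
(** For a good non-defective [mu], the set [S] of finite clopen values is closed
    under differences (goodness) and unbounded (the non-defective part is a
    countable union of clopen sets of finite measure), hence closed under sums:
    [a + b] can be carved out of a clopen set of measure at least [a + b]. So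
    [S] is the nonnegative part of a group, dense because a clopen set of a
    perfect space can be split indefinitely.

    Conversely, split every positive point [d] of [D] in [[0, +oo]] into [d-]
    and [d+]. The order topology makes this a Cantor space, Lebesgue measure is
    carried to it, and its only defective point is [+oo]. A clopen set is a
    finite union of intervals with end points in [D], so its measure is in
    [D] or infinite, and cutting it off at a suitable point of [D] gives a
    clopen subset of any smaller measure in [D]. *)

Require Import Defs.
From HB Require Import structures.
From mathcomp Require Import all_boot all_order all_algebra.
From mathcomp Require Import all_classical all_reals all_analysis.

Set Implicit Arguments.
Unset Strict Implicit.
Unset Printing Implicit Defensive.

Import Order.TTheory GRing.Theory Num.Theory.
Import numFieldNormedType.Exports.

Local Open Scope classical_set_scope.
Local Open Scope ring_scope.

(** * Group-like sets and closure under sums and differences *)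

Lemma natmul_closed (R : realType) (D : set R) (d : R) (n : nat) :
  D 0 -> (forall a b, D a -> D b -> D (a + b)) -> D d -> D (d *+ n).
Proof.
by move=> D0 Dadd Dd; elim: n => [|n IH]; rewrite ?mulr0n// mulrS; exact: Dadd.
Qed.

(** The largest multiple of a small [d] that does not exceed [x] lies within [d] of [x]. *)
Lemma dense_of_small (R : realType) (D : set R) :
  D 0 -> (forall a b, D a -> D b -> D (a + b)) ->
  (forall eps, 0 < eps -> exists2 d, D d & 0 < d < eps) ->
  `[0, +oo[ `<=` closure D.
Proof.
move=> D0 Dadd Dsmall x /=; rewrite in_itv/= andbT => x0 B.
move=> /nbhs_ballP[e/= e0 xeB].
have [d Dd /andP[d0 de]] := Dsmall _ e0.
exists (d *+ Num.truncn (x / d)); split; first exact: natmul_closed.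
apply: xeB; rewrite /ball/= -mulr_natl.
have /truncn_itv/andP[] : 0 <= x / d by rewrite divr_ge0// ltW.
rewrite ler_pdivlMr// ltr_pdivrMr// -[in X in _ -> X -> _]natr1 mulrDl mul1r.
move=> h1 h2; rewrite ger0_norm ?subr_ge0//.
by rewrite (lt_trans _ de)// ltrBlDl.
Qed.

(* [D] is then the nonnegative part of the group of all [x] with [x] or [- x]
   in [D], so a single group serves every [gamma]. *)
Lemma group_like_of_closed (R : realType) (D : set R) :
  (forall a, D a -> 0 <= a) -> D 0 ->
  (forall a b, D a -> D b -> D (a + b)) ->
  (forall a b, D a -> D b -> a <= b -> D (b - a)) ->
  countable D -> ~ has_ubound D ->
  (forall eps, 0 < eps -> exists2 d, D d & 0 < d < eps) ->
  group_like D.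
Proof.
move=> Dge0 D0 Dadd Dsub Dcount Dunb Dsmall; split => //.
- by move=> a /Dge0 a0; rewrite /= in_itv/= a0.
- exact: dense_of_small.
- move=> g Dg; exists (fun x => `[< D x \/ D (- x) >]).
    have Dsub' a b : D a -> D b -> D (a - b) \/ D (- (a - b)).
      move=> Da Db; rewrite opprB; have [ba|/ltW ab] := leP b a.
        by left; exact: Dsub.
      by right; exact: Dsub.
    split; first by apply/asboolP; left.
    move=> x y /asboolP[Dx|Dx] /asboolP[Dy|Dy]; apply/asboolP.
    + exact: Dsub'.
    + by left; exact: Dadd.
    + by right; rewrite opprB addrC; exact: Dadd.
    + by have := Dsub' _ _ Dy Dx; rewrite opprK addrC.
  apply/seteqP; split=> x /=; rewrite in_itv/= => -[Dx xg]; split => //.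
    by apply/asboolP; left.
  case/asboolP: Dx => // Dx; have := Dge0 _ Dx; rewrite oppr_ge0 => x0.
  by have -> : x = 0 by apply/eqP; rewrite eq_le x0; case/andP: xg.
Qed.

(** The group in [group_like] depends on [gamma]. Unboundedness supplies a point [c] of [D] beyond
    [a + b]; the group attached to [c] contains [a] and [b], and agrees with [D] at their sum and
    difference. *)
Lemma group_like_closed (R : realType) (D : set R) : group_like D ->
  (forall a b, D a -> D b -> D (a + b)) /\
  (forall a b, D a -> D b -> a <= b -> D (b - a)).
Proof.
move=> [Dge0 _ _ Dunb Dgrp].
have ge0 a : D a -> 0 <= a by move=> /Dge0; rewrite /= in_itv/= andbT.
have unb x : exists2 c, D c & x < c.
  apply: contrapT => h; apply: Dunb; exists x => c Dc.
  by rewrite leNgt; apply/negP => xc; apply: h; exists c.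
have mem a b (x : R) : D a -> D b -> 0 <= x -> x <= a + b ->
    (forall G : {pred R}, zmod_closed G -> a \in G -> b \in G -> x \in G) -> D x.
  move=> Da Db x0 xab Gx; have [c Dc abc] := unb (a + b).
  have [G Gz DG] := Dgrp _ Dc.
  have sub y : D y -> y <= a + b -> y \in G.
    move=> Dy yab; have : (D `&` `[0, c]) y.
      by split => //=; rewrite in_itv/= ge0//= (le_trans yab)// ltW.
    by rewrite DG => -[].
  have : ([set` G] `&` `[0, c]) x.
    split; last by rewrite /= in_itv/= x0/= (le_trans xab)// ltW.
    apply: Gx => //; apply: sub => //.
      by rewrite lerDl ge0.
    by rewrite lerDr ge0.
  by rewrite -DG => -[].
split => a b Da Db.
- apply: (mem _ _ _ Da Db) => //; first by rewrite addr_ge0// ge0.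
  by move=> G /GRing.zmod_closedD[_ GD] aG bG; exact: GD.
- move=> ab; apply: (mem _ _ _ Da Db); first by rewrite subr_ge0.
    by rewrite lerBlDl addrA lerDr addr_ge0// ge0.
  by move=> G [G0 GB] aG bG; apply: GB.
Qed.

(** * The clopen values of a good measure *)

Section clopen_values_group_like.
Context {R : realType} {X : pmetricType R} (mu : borelMeasure R X).
Hypotheses (Xcantor : cantor_metric_space X) (mu0 : M0_infty mu).
Implicit Types U V : set X.

Lemma clopen_measurable U :
  clopen U -> measurable (U : set (g_sigma_algebraType (@open X))).
Proof. by move=> [oU _]; exact: sub_sigma_algebra. Qed.

Lemma clopenD U V : clopen U -> clopen V -> clopen (U `\` V).
Proof. by move=> cU cV; rewrite setDE; apply: clopenI => //; exact: clopenC. Qed.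

Lemma measure_clopenD U V : clopen U -> clopen V -> U `<=` V ->
  (mu U < +oo)%E -> mu (V `\` U) = (mu V - mu U)%E.
Proof.
move=> cU cV UV Ufin; have mU := clopen_measurable cU.
have mV := clopen_measurable cV.
have mVU := clopen_measurable (clopenD cV cU).
rewrite -{2}(setDUK UV) measureU//; last exact: setDIK.
by rewrite [X in (X - _)%E]addeC addeK// ge0_fin_numE.
Qed.

(** If [M] bounded the finite values, the union of all clopen sets of finite measure would have
    measure at most [M]. Its complement is the defective set, which is null, so the whole space
    would have finite measure. *)
Lemma clopen_values_unbounded : ~ has_ubound (clopen_values mu).
Proof.
have [[_ _ muT] mudef] := mu0.
case=> M Mub; case: Xcantor => _ cptX _ _.
(* [F] enumerates the clopen sets, [G] discards those of infinite measure, and the [H n] increase,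
   so that continuity from below applies. *)
pose F := unsquash (@clopen_surj R X cptX).
have Fclopen n : clopen (F n) by exact: (@funS _ _ _ _ F).
pose G n := if (mu (F n) < +oo)%E then F n else set0.
pose H n := \big[setU/set0]_(i < n) G i.
have clG n : clopen (G n) by rewrite /G; case: ifP => // _; exact: clopen0.
have Gfin n : (mu (G n) < +oo)%E by rewrite /G; case: ifPn => //; rewrite measure0.
have clH n : clopen (H n) by apply: big_ind => //; [exact: clopen0|exact: clopenU].
have Hfin n : (mu (H n) < +oo)%E.
  rewrite /H; elim: n => [|n IH]; first by rewrite big_ord0 measure0.
  rewrite big_ord_recr/=; apply: le_lt_trans (lte_add_pinfty IH (Gfin n)).
  by apply: measureU2; [exact: clopen_measurable (clH n)|exact: clopen_measurable (clG n)].
have HM n : (mu (H n) <= M%:E)%E.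
  rewrite -(@fineK _ (mu (H n))) ?ge0_fin_numE// lee_fin; apply: Mub.
  by exists (H n) => //; rewrite fineK// ge0_fin_numE.
have mH n := clopen_measurable (clH n).
have mHU : measurable (\bigcup_n H n : set (g_sigma_algebraType (@open X))).
  exact: bigcup_measurable.
have HU : (mu (\bigcup_n H n) <= M%:E)%E.
  have Hcvg : mu (H n) @[n --> \oo] --> mu (\bigcup_n H n).
    apply: nondecreasing_cvg_mu => // m n mn.
    by apply/subsetPset; exact: subset_bigsetU.
  by rewrite -(cvg_lim _ Hcvg)//; apply: lime_le; [exact: cvgP Hcvg|exact: nearW].
have defE : ~` (\bigcup_n H n) = defective_set mu.
  apply/seteqP; split=> x /=.
  - move=> xH U cU Ux; apply: contrapT => /eqP Ufin; apply: xH.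
    have [n _ Fn] := @surj _ _ _ _ F U cU.
    exists n.+1 => //; rewrite /H big_ord_recr/=; right.
    by rewrite /G Fn ltey Ufin.
  - move=> xdef [n _ Hx]; have := Hfin n.
    by rewrite (xdef _ (clH n) Hx).
suff : (mu setT <= M%:E + 0)%E by rewrite muT.
rewrite -(setUv (\bigcup_n H n)).
have def0 : (mu (~` (\bigcup_n H n)) <= 0)%E by rewrite defE mudef.
apply: le_trans (leeD HU def0).
by apply: measureU2 => //; exact: measurableC.
Qed.

(* A non-empty clopen set has at least two points, hence splits into two
   non-empty clopen pieces, one of which has at most half the measure. *)
Lemma clopen_values_small eps : 0 < eps ->
  exists2 d, clopen_values mu d & 0 < d < eps.
Proof.
have [[full _ muT] mudef] := mu0; move=> eps0.
case: Xcantor => -[_ Xlim] cptX _ Xzd.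
have half U r : clopen U -> U !=set0 -> mu U = r%:E ->
    exists (V : set X) s, [/\ clopen V, V !=set0, mu V = s%:E & s <= r / 2].
  move=> cU [x Ux] muU.
  have [y [yx _ Uy]] : exists y, [/\ y != x, [set: X] y & U y].
    have : limit_point [set: X] x by rewrite Xlim.
    by apply; apply: open_nbhs_nbhs; split => //; case: cU.
  have [W [cW Wy nWx]] := Xzd _ _ yx.
  have cUW := clopenI cU cW.
  have UWU : U `&` W `<=` U by exact: subIsetl.
  have muUW : (mu (U `&` W) <= r%:E)%E.
    by rewrite -muU; apply: le_measure => //; rewrite inE; exact: clopen_measurable.
  have muUWfin : (mu (U `&` W) < +oo)%E by apply: le_lt_trans muUW _; rewrite ltry.
  set s := fine (mu (U `&` W)).
  have muUWE : mu (U `&` W) = s%:E by rewrite fineK// ge0_fin_numE.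
  have [sr|sr] := leP s (r / 2).
    by exists (U `&` W), s; split => //; exists y.
  exists (U `\` (U `&` W)), (r - s); split.
  - exact: clopenD.
  - by exists x; split => // -[].
  - by rewrite measure_clopenD// muUWE muU.
  - by rewrite lerBlDl; apply: le_trans (lerD (ltW sr) (lexx _)); rewrite -splitr.
have [U [r [cU U0 muU]]] :
    exists (U : set X) r, [/\ clopen U, U !=set0 & mu U = r%:E].
  have [r [U cU muU] r0] : exists2 r, clopen_values mu r & 0 < r.
    apply: contrapT => h; apply: clopen_values_unbounded; exists 0 => r Sr.
    by rewrite leNgt; apply/negP => r0; apply: h; exists r.
  exists U, r; split => //; apply/set0P/eqP => U0.
  by move: muU; rewrite U0 measure0 => -[] r0'; rewrite -r0' ltxx in r0.
have halves n : exists (V : set X) s,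
    [/\ clopen V, V !=set0, mu V = s%:E & s <= r / 2 ^+ n].
  elim: n => [|n [V [s [cV V0 muV sn]]]].
    by exists U, r; split => //; rewrite expr0 divr1.
  have [W [t [cW W0 muW ts]]] := half _ _ cV V0 muV.
  exists W, t; split => //; apply: le_trans ts _.
  by rewrite exprSr invfM mulrA ler_pM2r// invr_gt0.
have r0 : 0 < r by rewrite -lte_fin -muU; apply: full => //; case: cU.
have [n rn] : exists n : nat, r / 2 ^+ n < eps.
  (* Since [n < 2 ^ n], any [n] above [r / eps] works. *)
  exists (Num.truncn (r / eps)).+1; rewrite ltr_pdivrMr ?exprn_gt0//.
  rewrite -ltr_pdivrMl// mulrC; apply: lt_trans (truncnS_gt _) _.
  by rewrite -natrX ltr_nat ltn_expl.
have [V [s [cV V0 muV sn]]] := halves n.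
exists s; first by exists V.
rewrite (le_lt_trans sn rn) andbT -lte_fin -muV.
by apply: full => //; case: cV.
Qed.

Hypothesis mugood : good_measure mu.

Lemma good_subset U V : clopen U -> clopen V -> (mu U <= mu V)%E ->
  exists W : set X, [/\ clopen W, W `<=` V & mu W = mu U].
Proof.
move=> cU cV; rewrite le_eqVlt => /predU1P[UV|]; last exact: mugood.
by exists V; split.
Qed.

Lemma clopen_values_ge0 a : clopen_values mu a -> 0 <= a.
Proof. by move=> [U _ muU]; rewrite -lee_fin -muU. Qed.

Lemma clopen_values_sub a b : clopen_values mu a -> clopen_values mu b ->
  a <= b -> clopen_values mu (b - a).
Proof.
move=> [U cU muU] [V cV muV] ab.
have [|W [cW WV muW]] := good_subset cU cV; first by rewrite muU muV lee_fin.
exists (V `\` W); first exact: clopenD.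
by rewrite measure_clopenD// muW muU ?muV// ltry.
Qed.

Lemma clopen_values_add a b : clopen_values mu a -> clopen_values mu b ->
  clopen_values mu (a + b).
Proof.
move=> [U cU muU] [V cV muV].
have [c [Z cZ muZ] abc] : exists2 c, clopen_values mu c & a + b <= c.
  apply: contrapT => h; apply: clopen_values_unbounded; exists (a + b) => c Sc.
  by rewrite leNgt; apply/negP => abc; apply: h; exists c => //; rewrite ltW.
have b0 : 0 <= b by apply: clopen_values_ge0; exists V.
have [|W [cW WZ muW]] := good_subset cU cZ.
  by rewrite muU muZ lee_fin (le_trans _ abc)// lerDl.
have Wfin : (mu W < +oo)%E by rewrite muW muU ltry.
have cZW : clopen (Z `\` W) by exact: clopenD.
(* What is left of [Z] has measure [c - a], which is at least [b], so goodness applies a second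
   time. *)
have [|W' [cW' W'Z muW']] := good_subset cV cZW.
  by rewrite muV measure_clopenD// muW muU muZ lee_fin lerBrDl.
exists (W `|` W'); first exact: clopenU.
have -> : mu (W `|` W') = (mu W + mu W')%E.
  apply: measureU; [exact: clopen_measurable..|].
  by rewrite -subset0 => x [Wx /W'Z[]].
by rewrite muW muW' muU muV.
Qed.

Lemma clopen_values_group_like : group_like (clopen_values mu).
Proof.
apply: group_like_of_closed.
- exact: clopen_values_ge0.
- by exists set0; [exact: clopen0|rewrite measure0].
- exact: clopen_values_add.
- exact: clopen_values_sub.
- case: Xcantor => _ cptX _ _.
  have cnt : countable (@clopen X).
    exact/clopen_countable/compact_second_countable.
  apply: (@sub_countable _ _ _ [set fine (mu U) | U in @clopen X]).
    apply: subset_card_le => r [U cU muU]; exists U => //.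
    by rewrite muU.
  exact: card_le_trans (card_image_le _ _) cnt.
- exact: clopen_values_unbounded.
- exact: clopen_values_small.
Qed.

End clopen_values_group_like.

(** * The space of cuts and its metric *)

(* The point of the split half-line is encoded by the set of [n] such that [e n]
   lies below it; [e] enumerates the positive elements of [D]. *)
Record cut (R : realType) (e : nat -> R) := Cut {
  below :> nat -> bool ;
  below_mono : forall i j, e i <= e j -> below j -> below i }.

Lemma cut_ext (R : realType) (e : nat -> R) (f g : cut e) :
  (forall n, f n = g n) -> f = g.
Proof.
case: f g => [f fP] [g gP] /= /funext fg; subst g.
by congr Cut; exact: Prop_irrelevance.
Qed.

(* A split point [x] is sent to its right copy. Negative reals are sent to the
   same cut as [0]. *)
Definition real_cut (R : realType) (e : nat -> R) (x : R) : cut e :=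
  @Cut R e (fun n => e n <= x) (fun i j => @le_trans _ _ _ _ _).

Section cut_metric.
Context {R : realType} {e : nat -> R}.
Implicit Types f g h : cut e.

HB.instance Definition _ := gen_eqMixin (cut e).
HB.instance Definition _ := gen_choiceMixin (cut e).
HB.instance Definition _ := isPointed.Build (cut e) (real_cut e 0).

(** The usual ultrametric on binary sequences, governed by the first index of disagreement. *)
Definition cut_dist f g : R :=
  if pselect (exists n, f n != g n) is left fg then (ex_minn fg).+1%:R^-1 else 0.

Lemma cut_dist_ge f g n : f n != g n -> n.+1%:R^-1 <= cut_dist f g.
Proof.
move=> fgn; rewrite /cut_dist; case: pselect => [fg|[]]; last by exists n.
by case: ex_minnP => m _ /(_ _ fgn) mn; rewrite lef_pV2 ?posrE// ler_nat.
Qed.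

Lemma cut_dist_cases f g :
  f = g /\ cut_dist f g = 0 \/
  exists2 n, f n != g n & cut_dist f g = n.+1%:R^-1.
Proof.
rewrite /cut_dist; case: pselect => [fg|fg].
  by right; case: ex_minnP => n fgn _; exists n.
by left; split => //; apply: cut_ext => n; apply/eqP/negPn/negP => ?; apply: fg; exists n.
Qed.

Lemma cut_dist_ge0 f g : 0 <= cut_dist f g.
Proof. by have [[_ ->]//|[n _ ->]] := cut_dist_cases f g. Qed.

Lemma cut_distxx f : cut_dist f f = 0.
Proof. by have [[]//|[n]] := cut_dist_cases f f; rewrite eqxx. Qed.

Lemma cut_dist_eq0 f g : cut_dist f g = 0 -> f = g.
Proof.
have [[]//|[n _ ->]] := cut_dist_cases f g.
by move/eqP; rewrite invr_eq0 pnatr_eq0.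
Qed.

Lemma cut_dist_sym f g : cut_dist f g = cut_dist g f.
Proof.
suff h f' g' : cut_dist f' g' <= cut_dist g' f' by apply/eqP; rewrite eq_le !h.
have [[_ ->]|[n fg ->]] := cut_dist_cases f' g'; first exact: cut_dist_ge0.
by apply: cut_dist_ge; rewrite eq_sym.
Qed.

(** At the first index where [f] and [h] differ, [g] differs from one of them. *)
Lemma cut_dist_triangle g f h : cut_dist f h <= cut_dist f g + cut_dist g h.
Proof.
have [[_ ->]|[n fh ->]] := cut_dist_cases f h; first by rewrite addr_ge0// cut_dist_ge0.
have [fg|fg] := eqVneq (f n) (g n).
  by rewrite ler_wpDl ?cut_dist_ge0// cut_dist_ge// -fg.
by rewrite ler_wpDr ?cut_dist_ge0// cut_dist_ge.
Qed.

HB.instance Definition _ := isMetric.Build R (cut e)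
  cut_distxx cut_dist_eq0 cut_dist_sym cut_dist_triangle.

Lemma nbhs_cutP f (A : set (cut e)) :
  nbhs f A <-> exists N, forall g, (forall n, (n < N)%N -> g n = f n) -> A g.
Proof.
split=> [/nbhs_ballP[r/= r0 rA]|[N NA]].
(* Cuts whose first disagreement comes after index [r^-1] are at distance less than [r]. *)
- exists (Num.truncn r^-1).+1 => g fg; apply: rA; rewrite ballEmdist; change (cut_dist f g < r).
  have [[_ ->]//|[n fgn ->]] := cut_dist_cases f g.
  have nr : (Num.truncn r^-1 < n)%N.
    by rewrite ltnNge; apply/negP => nr; rewrite fg ?eqxx in fgn.
  rewrite invf_plt ?posrE//; apply: lt_le_trans (truncnS_gt _) _.
  by rewrite ler_nat ltnW.
- apply/nbhs_ballP; exists N.+1%:R^-1 => /=; first by rewrite invr_gt0.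
  move=> g; rewrite ballEmdist => fgN.
  apply: NA => n nN; apply/eqP/negPn/negP => gfn.
  have := cut_dist_ge gfn; rewrite cut_dist_sym leNgt => /negP; apply.
  by apply: lt_le_trans (fgN : cut_dist f g < _) _; rewrite lef_pV2 ?posrE// ler_nat ltnW.
Qed.

End cut_metric.

(** * Topology of the space of cuts *)

Section cut_topology.
Context {R : realType} {e : nat -> R}.
Implicit Types f g : cut e.

Lemma near_cut f N : nbhs f [set g : cut e | forall n, (n < N)%N -> g n = f n].
Proof. by apply/nbhs_cutP; exists N. Qed.

(** An ultrafilter decides every coordinate. The decided values [p] are again monotone, because [F]
    is closed under supersets, and form the limit. *)
Lemma cut_compact : compact [set: cut e].
Proof.
rewrite compact_ultra => F FU _.
pose p n : bool := `[< F [set f : cut e | f n] >].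
have Fp n : F [set f : cut e | f n = p n].
  have [Fn|Fn] := @in_ultra_setVsetC _ F [set f : cut e | f n] FU.
    by apply: filterS (Fn) => f /= ->; apply/esym/asboolP.
  apply: filterS (Fn) => f /= /negP/negbTE ->; apply/esym/negbTE/asboolP => Fn'.
  have /filter_ex[g []] : F ([set f : cut e | f n] `&` ~` [set f : cut e | f n]).
    exact: filterI.
  by [].
have p_mono i j : e i <= e j -> p j -> p i.
  move=> ij /asboolP Fj; apply/asboolP; apply: filterS Fj => f /=.
  exact: below_mono.
exists (Cut p_mono); split => // A /nbhs_cutP[N NA].
suff : F [set f : cut e | forall n, (n < N)%N -> f n = p n] by apply: filterS.
elim: N {NA} => [|N IH]; first exact: filterS filterT.
apply: filterS2 IH (Fp N) => f fN fpN n; rewrite ltnS leq_eqVlt.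
by move=> /predU1P[->//|]; exact: fN.
Qed.

Lemma below_clopen n : clopen [set f : cut e | f n].
Proof.
split; rewrite ?openE; last rewrite -openC openE.
  move=> f /= fn; apply: filterS (near_cut f n.+1) => g /= -> //.
move=> f /= fn; apply: filterS (near_cut f n.+1) => g /= -> //.
Qed.

Lemma cut_zero_dimensional : zero_dimensional (cut e).
Proof.
move=> f g /eqP fg; have [n fgn] : exists n, f n <> g n.
  by apply/existsNP => h; apply: fg; exact: cut_ext.
have [fn|fn] := boolP (f n).
  exists [set h : cut e | h n]; split => //; first exact: below_clopen.
  by move=> /= gn; apply: fgn; rewrite fn gn.
exists (~` [set h : cut e | h n]); split => /=.
- exact: (clopenC setT (below_clopen n)).
- exact/negP.
- by move=> /negP/negbTE gn; apply: fgn; rewrite gn (negbTE fn).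
Qed.

(** Otherwise there are, for every [N], two cuts agreeing below [N] and separated by [U]. By
    compactness the first ones cluster at some [p]; close to [p] both cuts of a pair lie on the same
    side of [U] as [p]. *)
Lemma clopen_finitely_determined (U : set (cut e)) : clopen U ->
  exists N, forall f g, (forall n, (n < N)%N -> f n = g n) -> U f -> U g.
Proof.
move=> cU; apply: contrapT => /forallNP h.
have {}h N : exists fg : cut e * cut e,
    [/\ forall n, (n < N)%N -> fg.1 n = fg.2 n, U fg.1 & ~ U fg.2].
  have /existsNP[f /existsNP[g /not_implyP[fgN /not_implyP[Uf nUg]]]] := h N.
  by exists (f, g).
have {h}[fg fgP] := choice h.
have [p [_ p_cluster]] := cut_compact
  (fmap_proper_filter (fun N => (fg N).1) eventually_filter) (filterS (fun _ _ => I) filterT).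
suff contra V : clopen V -> V p -> exists N, V (fg N).1 /\ V (fg N).2.
  have [Up|nUp] := pselect (U p).
    by have [N [_ UfN]] := contra _ cU Up; case: (fgP N).
  have [N [nUf _]] := contra _ (clopenC setT cU) nUp.
  by case: (fgP N).
move=> [oV _] Vp; have /nbhs_cutP[N0 N0V] : nbhs p V by exact: open_nbhs_nbhs.
(* Only pairs with [N0 <= N] are considered, so that the second cut inherits the first [N0]
   coordinates of the first one. *)
have FN0 : ((fun N => (fg N).1) @ \oo) [set (fg N).1 | N in [set N | (N0 <= N)%N]].
  by exists N0 => // N N0N; exists N.
have [_ [[N N0N <-] fgp]] := p_cluster _ _ FN0 (near_cut p N0).
 exists N; split; apply: N0V => // n nN0; rewrite -fgp//.
by have [-> //] := fgP N; exact: leq_trans N0N.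
Qed.

Hypothesis e_gt0 : forall n, 0 < e n.
Hypothesis e_dense : forall a b, 0 <= a -> a < b -> exists n, a < e n < b.

Lemma cut_gap f N : exists a b, [/\ 0 <= a, a < b &
  forall x, a <= x < b -> forall n, (n < N)%N -> real_cut e x n = f n].
Proof.
have [a [a_attained aN]] : exists a, (a = 0 \/ exists2 i, f i & e i = a) /\
    forall n, (n < N)%N -> f n -> e n <= a.
  elim: N => [|N [a [aat aN]]]; first by exists 0; split => //; left.
  have [fN|fN] := boolP (f N && (a < e N)).
    case/andP: fN => fN aeN; exists (e N); split; first by right; exists N.
    move=> n; rewrite ltnS leq_eqVlt => /predU1P[->//|nN] fn.
    by rewrite ltW// (le_lt_trans _ aeN)// aN.
  exists a; split => // n; rewrite ltnS leq_eqVlt => /predU1P[-> fN'|]; last exact: aN.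
  by rewrite leNgt; move: fN; rewrite fN'.
have a_lt n : ~~ f n -> a < e n.
  case: a_attained => [->//|[i fi <-]]; rewrite ltNge; apply: contra => ni.
  exact: below_mono fi.
have [b [ab bN]] : exists b, a < b /\ forall n, (n < N)%N -> ~~ f n -> b <= e n.
  elim: N {aN} => [|N [b [ab bN]]]; first by exists (a + 1); rewrite ltrDl.
  have [fN|fN] := boolP (f N).
    exists b; split => // n; rewrite ltnS leq_eqVlt => /predU1P[->|]; last exact: bN.
    by rewrite fN.
  exists (Num.min b (e N)); split; first by rewrite lt_min ab a_lt.
  move=> n; rewrite ltnS leq_eqVlt ge_min => /predU1P[->|nN fn].
    by rewrite lexx orbT.
  by rewrite bN.
have a0 : 0 <= a by case: a_attained => [->//|[i _ <-]]; rewrite ltW.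
exists a, b; split => // x /andP[ax xb] n nN /=.
have [fn|fn] := boolP (f n); first by rewrite (le_trans _ ax)// aN.
by apply/negbTE; rewrite -ltNge (lt_le_trans xb)// bN.
Qed.

Lemma cut_perfect : perfect_set [set: cut e].
Proof.
split; first exact: closedT.
apply/seteqP; split => // f _ A /nbhs_cutP[N NA].
have [a [b [a0 ab gapP]]] := cut_gap f N.
(* The cuts of [a] and of [e n] both agree with [f] below [N] but differ from each other at [n], so
   one of them is not [f]. *)
have [n /andP[an nb]] := e_dense a0 ab.
have [fn|fn] := boolP (f n).
- exists (real_cut e a); split => //.
    by apply: contraTneq fn => <- /=; rewrite -ltNge.
  by apply: NA; apply: gapP; rewrite lexx.
- exists (real_cut e (e n)); split => //.
    by apply: contraNneq fn => <- /=.
  by apply: NA; apply: gapP; rewrite nb ltW.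
Qed.

Lemma cut_cantor_like : cantor_like (cut e).
Proof.
split; [exact: cut_perfect|exact: cut_compact|exact: metric_hausdorff|].
exact: cut_zero_dimensional.
Qed.

End cut_topology.

(** * Lebesgue measure of sets given by finitely many comparisons *)

Section finitely_determined_sets.
Context {R : realType} (D : set R) (e : nat -> R).
Hypotheses (D0 : D 0) (Dge0 : forall a, D a -> 0 <= a)
  (Dadd : forall a b, D a -> D b -> D (a + b))
  (Dsub : forall a b, D a -> D b -> a <= b -> D (b - a))
  (eD : forall n, D (e n)).

Local Notation lambda := (@lebesgue_measure R).

Lemma lebesgue_itv_co (a b : R) : a <= b -> lambda `[a, b[ = (b - a)%:E.
Proof.
rewrite lebesgue_measure_itv/= lte_fin le_eqVlt => /predU1P[->|->].
  by rewrite ltxx subrr.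
by rewrite EFinB.
Qed.

Lemma setI_itv_split (A : set R) (a m b : R) : a <= m -> m <= b ->
  A `&` `[a, b[ = (A `&` `[a, m[) `|` (A `&` `[m, b[).
Proof.
move=> am mb; rewrite -setIUr; congr (_ `&` _); apply/seteqP; split=> x /=.
  rewrite !in_itv/= => /andP[ax xb]; have [xm|mx] := ltP x m.
    by left; rewrite ax.
  by right; rewrite xb.
rewrite !in_itv/= => -[/andP[ax xm]|/andP[mx xb]].
  by rewrite ax (lt_le_trans xm).
by rewrite (le_trans am mx).
Qed.

Lemma lebesgueI_itv_split (A : set R) (a m b : R) : a <= m -> m <= b ->
  measurable (A `&` `[a, m[) -> measurable (A `&` `[m, b[) ->
  lambda (A `&` `[a, b[) = (lambda (A `&` `[a, m[) + lambda (A `&` `[m, b[))%E.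
Proof.
move=> am mb m1 m2; rewrite (setI_itv_split _ am mb); apply: measureU => //.
rewrite -subset0 => x [[_ +] [_]]; rewrite /= !in_itv/= => /andP[_ xm] /andP[mx _].
by move: (lt_le_trans xm mx); rewrite ltxx.
Qed.

(** Relative to an interval, so that an induction on [N] can cut at [e N]: on either half the
    comparison with [e N] is constant. *)
Definition determined_on N (A : set R) (a b : R) :=
  forall x y, a <= x < b -> a <= y < b ->
    (forall n, (n < N)%N -> (e n <= x) = (e n <= y)) -> A x -> A y.

(* Splitting the interval at [e N] gets rid of the [N]-th condition. *)
Lemma determined_measure N (A : set R) (a b : R) :
  D a -> D b -> a <= b -> determined_on N A a b ->
  measurable (A `&` `[a, b[) /\
  exists2 r, D r & lambda (A `&` `[a, b[) = r%:E /\
    forall c, D c -> c <= r ->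
      exists t, [/\ D t, a <= t, t <= b & lambda (A `&` `[a, t[) = c%:E].
Proof.
elim: N a b => [|N IH] a b Da Db ab AN.
  (* Without conditions, [A] contains all of the interval or none of it. *)
  have [[x [Ax xab]]|nA] := pselect (exists x, A x /\ a <= x < b).
    have sub t : t <= b -> A `&` `[a, t[ = `[a, t[%classic.
      move=> tb; rewrite setIC; apply: setIidl => y /=; rewrite in_itv/= => /andP[ay yt].
      by apply: (AN x y) => //; rewrite ay (lt_le_trans yt).
    rewrite sub//; split => //; exists (b - a); first exact: Dsub.
    split; first exact: lebesgue_itv_co.
    move=> c Dc cba; exists (a + c); have c0 := Dge0 Dc.
    rewrite sub; last by rewrite addrC -lerBrDr.
    split; [exact: Dadd|by rewrite lerDl|by rewrite addrC -lerBrDr|].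
    by rewrite lebesgue_itv_co ?lerDl// addrC addKr.
  have sub t : t <= b -> A `&` `[a, t[ = set0.
    move=> tb; rewrite -subset0 => y [Ay]; rewrite /= in_itv/= => /andP[ay yt].
    by apply: nA; exists y; rewrite ay (lt_le_trans yt).
  rewrite sub//; split => //; exists 0 => //; split; first by rewrite measure0.
  move=> c Dc c0; exists a; split => //; rewrite sub// measure0.
  by congr EFin; apply/eqP; rewrite eq_le c0 Dge0.
(* When [e N] is not interior to the interval, the [N]-th comparison is already constant there. *)
have [/andP[am mb]|eN] := boolP (a < e N < b); last first.
  apply: IH => // x y xab yab xyN; apply: AN => // n.
  rewrite ltnS leq_eqVlt => /predU1P[->|]; last exact: xyN.
  move: eN; rewrite negb_and -!leNgt => /orP[eNa|beN].
    by case/andP: xab yab => ax _ /andP[ay _]; rewrite !(le_trans eNa).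
  case/andP: xab yab => _ xb /andP[_ yb].
  by rewrite !leNgt (lt_le_trans xb)// (lt_le_trans yb).
have [xam xmb] : a <= e N /\ e N <= b by rewrite !ltW.
have det1 : determined_on N A a (e N).
  move=> x y /andP[ax xm] /andP[ay ym] xyN; apply: AN.
  - by rewrite ax (lt_trans xm).
  - by rewrite ay (lt_trans ym).
  - move=> n; rewrite ltnS leq_eqVlt => /predU1P[->|]; last exact: xyN.
    by rewrite !leNgt xm ym.
have det2 : determined_on N A (e N) b.
  move=> x y /andP[mx xb] /andP[my yb] xyN; apply: AN.
  - by rewrite xb (le_trans xam).
  - by rewrite yb (le_trans xam).
  - move=> n; rewrite ltnS leq_eqVlt => /predU1P[->|]; last exact: xyN.
    by rewrite mx my.
have [m1 [r1 Dr1 [lr1 cut1]]] := IH _ _ Da (eD N) xam det1.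
have [m2 [r2 Dr2 [lr2 cut2]]] := IH _ _ (eD N) Db xmb det2.
split; first by rewrite (setI_itv_split _ xam xmb); exact: measurableU.
exists (r1 + r2); first exact: Dadd.
split; first by rewrite (lebesgueI_itv_split xam xmb)// lr1 lr2.
(* A mass [c] up to [r1] is reached in the left half; otherwise the left half is kept whole and the
   remainder [c - r1], again in [D], is reached in the right half. *)
move=> c Dc cr; have [cr1|/ltW r1c] := leP c r1.
  have [t [Dt at_ tm lt]] := cut1 _ Dc cr1.
  by exists t; split => //; exact: le_trans xmb.
have [||t [Dt mt tb lt]] := cut2 (c - r1); [exact: Dsub|by rewrite lerBlDl|].
exists t; split => //; first exact: le_trans mt.
rewrite (lebesgueI_itv_split xam mt)// ?lr1 ?lt; first by rewrite -EFinD addrC subrK.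
rewrite (_ : A `&` `[e N, t[ = (A `&` `[e N, b[) `&` `[e N, t[).
  exact: measurableI.
rewrite -setIA; congr (_ `&` _); apply/esym/setIidr => x /=.
by rewrite !in_itv/= => /andP[-> /lt_le_trans->].
Qed.

End finitely_determined_sets.

(** * Transport of Lebesgue measure to the space of cuts *)

Section cut_measure.
Context {R : realType} (e : nat -> R).

Local Notation lambda := (@lebesgue_measure R).
Local Notation borel_cut := (g_sigma_algebraType (@open (cut e))).

Lemma finitely_determined_measurable N (A : set R) :
  (forall x y, (forall n, (n < N)%N -> (e n <= x) = (e n <= y)) -> A x -> A y) ->
  measurable A.
Proof.
elim: N A => [|N IH] A AN.
  have [[x Ax]|nA] := pselect (A !=set0).
    by rewrite (_ : A = setT)//; apply/seteqP; split => // y _; exact: AN Ax.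
  by rewrite (_ : A = set0)//; apply/seteqP; split => // y Ay; apply: nA; exists y.
(* [side b] forgets the comparison with [e N]: it saturates one part of [A] under the first [N]
   comparisons. Intersecting with the half-line on the proper side of [e N] recovers that part. *)
pose side b := [set x | exists y,
  [/\ forall n, (n < N)%N -> (e n <= x) = (e n <= y), (e N <= y) = b & A y]].
have mside b : measurable (side b).
  apply: IH => x y xyN [z [xz zb Az]]; exists z; split => // n nN.
  by rewrite -xyN// xz.
rewrite (_ : A = side true `&` `[e N, +oo[ `|` side false `&` `]-oo, e N[).
  by apply: measurableU; exact: measurableI.
have sideA x : side (e N <= x) x -> A x.
  move=> [y [xy yN Ay]]; apply: AN Ay => n; rewrite ltnS leq_eqVlt.
  by move=> /predU1P[->//|nN]; rewrite xy.
apply/seteqP; split=> x /=; rewrite !in_itv/= andbT.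
  by move=> Ax; have [Nx|xN] := leP (e N) x; [left|right]; split => //;
    exists x; split => //; apply/negbTE; rewrite -ltNge.
by move=> [[sx Nx]|[sx xN]]; apply: sideA; rewrite ?Nx//; move: xN; rewrite ltNge => /negbTE ->.
Qed.

Lemma real_cut_measurable :
  measurable_fun setT (real_cut e : R -> borel_cut).
Proof.
apply: (@measurability _ _ R borel_cut setT (real_cut e) (@open (cut e))) => //.
move=> _ [U oU <-]; rewrite setTI.
(* An open set is the union, over [N], of the cylinders of length [N] that it contains. *)
rewrite (_ : _ @^-1` U = \bigcup_N [set x | forall g : cut e,
    (forall n, (n < N)%N -> g n = real_cut e x n) -> U g]); last first.
  apply/seteqP; split=> x /=.
    move=> Ux; have /nbhs_cutP[N NU] : nbhs (real_cut e x) U by exact: open_nbhs_nbhs.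
    by exists N.
  by case=> N _; apply.
apply: bigcup_measurable => N _; apply: (@finitely_determined_measurable N).
by move=> x y xy xU g gy; apply: xU => n nN; rewrite gy//= xy.
Qed.

(** Without the restriction to [[0, +oo[], the negative reals would give the cut of [0] infinite
    mass when all [e n] are positive. *)
Lemma cut_measure_exists : exists mu : {measure set borel_cut -> \bar R},
  forall A, mu A = lambda (real_cut e @^-1` A `&` `[0, +oo[).
Proof.
unshelve eexists (pushforward (mrestr lambda (measurable_itv `[0, +oo[))
  (real_cut e : R -> borel_cut)); first exact: real_cut_measurable.
by [].
Qed.

End cut_measure.

(** * Fullness, non-atomicity, values and goodness of the transported measure *)

Section good_cut_measure.
Context {R : realType} (D : set R) (e : nat -> R).
Hypotheses (D0 : D 0) (Dge0 : forall a, D a -> 0 <= a)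
  (Dadd : forall a b, D a -> D b -> D (a + b))
  (Dsub : forall a b, D a -> D b -> a <= b -> D (b - a))
  (eD : forall n, D (e n)) (e_gt0 : forall n, 0 < e n)
  (e_surj : forall d, D d -> 0 < d -> exists n, e n = d)
  (e_dense : forall a b, 0 <= a -> a < b -> exists n, a < e n < b).

Local Notation lambda := (@lebesgue_measure R).

Variable mu : borelMeasure R (cut e).
Hypothesis muE : forall A : set (cut e),
  mu A = lambda (real_cut e @^-1` A `&` `[0, +oo[).
Implicit Types A U V : set (cut e).

Lemma e_unbounded x : exists n, x < e n.
Proof.
have [|n /andP[xn _]] := e_dense (normr_ge0 x) (_ : _ < `|x| + 1).
  by rewrite ltrDl.
by exists n; rewrite (le_lt_trans (ler_norm x)).
Qed.

Lemma measurable_preimage_real_cut A :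
  measurable (A : set (g_sigma_algebraType (@open (cut e)))) ->
  measurable (real_cut e @^-1` A).
Proof.
by move=> mA; rewrite -[X in measurable X]setTI; exact: real_cut_measurable.
Qed.

Lemma below_measurable n :
  measurable ([set f : cut e | f n] : set (g_sigma_algebraType (@open (cut e)))).
Proof. by apply: sub_sigma_algebra; case: (@below_clopen _ e n). Qed.

(** Truncating the half-line at [e n] thus amounts to removing a clopen set of cuts. *)
Lemma cut_measureD_below A n :
  mu (A `\` [set f : cut e | f n]) = lambda (real_cut e @^-1` A `&` `[0, e n[).
Proof.
rewrite muE; congr (lambda _); apply/seteqP; split=> x /=; rewrite !in_itv/= ?andbT.
  by move=> [[Ax /negP]]; rewrite -ltNge => xn ->.
by move=> [Ax /andP[-> xn]]; split => //; split => //; apply/negP; rewrite -ltNge.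
Qed.

Lemma cut_measure_full : full_measure mu.
Proof.
move=> U oU [f Uf].
have /nbhs_cutP[N NU] : nbhs f U by exact: open_nbhs_nbhs.
have [a [b [a0 ab abP]]] := cut_gap e_gt0 f N.
apply: (@lt_le_trans _ _ (lambda `[a, b[)).
  by rewrite lebesgue_itv_co ?ltW// lte_fin subr_gt0.
rewrite muE; apply: le_measure; rewrite ?inE//.
  apply: measurableI => //; apply: measurable_preimage_real_cut.
  exact: sub_sigma_algebra.
move=> x /=; rewrite !in_itv/= andbT => /andP[ax xb].
split; last exact: le_trans ax.
by apply: NU => n nN; apply: abP => //; rewrite ax.
Qed.

Lemma cut_measureT : mu setT = +oo%E.
Proof. by rewrite muE preimage_setT setTI lebesgue_measure_itv/= ltry. Qed.

(** The cut of a real [x] has a clopen neighbourhood of measure [e n] for any [e n] above [x], so no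
    defective cut comes from a real number. *)
Lemma cut_measure_defective : mu (defective_set mu) = 0%E.
Proof.
rewrite muE (_ : _ `&` _ = set0) ?measure0// -subset0 => x [/= xdef _].
have [n xn] := e_unbounded x.
have : mu (setT `\` [set f : cut e | f n]) = +oo%E.
  apply: xdef; first by rewrite setTD; exact: (clopenC setT (below_clopen n)).
  by split => //=; apply/negP; rewrite -ltNge.
by rewrite cut_measureD_below preimage_setT setTI lebesgue_itv_co// ltW.
Qed.

(** Choose [d] in [D] with [0 < d < mu A] and truncate [A] at the multiples of [d]. The first
    truncation of positive mass gains all of it in one step of length [d], so its mass is at most
    [d]. *)
Lemma cut_measure_non_atomic : non_atomic mu.
Proof.
move=> A mA A0.
have [d Dd /andP[d0 dA]] : exists2 d, D d & (0 < d%:E < mu A)%E.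
  have [r r0 rA] : exists2 r, 0 < r & (r%:E <= mu A)%E.
    case: (mu A) A0 => [r| |//] r0; first by exists r => //; rewrite -lte_fin.
    by exists 1 => //; rewrite leey.
  have [n /andP[n0 nr]] := e_dense (lexx 0) r0.
  by exists (e n) => //; rewrite lte_fin n0/= (lt_le_trans _ rA)// lte_fin.
pose m k := lambda (real_cut e @^-1` A `&` `[0, d *+ k[).
have mPA := measurable_preimage_real_cut mA.
have [k0 mk0] : exists k, (0 < m k)%E.
  apply: contrapT => /forallNP m0; move: A0; rewrite muE.
  have -> : lambda (real_cut e @^-1` A `&` `[0, +oo[) = 0%E; last by rewrite ltxx.
  apply: measure_negligible; first exact: measurableI.
  have sub : real_cut e @^-1` A `&` `[0, +oo[ `<=`
      \bigcup_k (real_cut e @^-1` A `&` `[0, d *+ k[).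
    move=> x [Ax]; rewrite /= in_itv/= andbT => x0.
    exists (Num.truncn (x / d)).+1 => //; split => //=.
    by rewrite in_itv/= x0/= -mulr_natl -ltr_pdivrMr// truncnS_gt.
  apply: (@negligibleS _ _ _ lambda _ _ sub); apply: negligible_bigcup => k.
  exists (real_cut e @^-1` A `&` `[0, d *+ k[); split => //.
    exact: measurableI.
  by apply/eqP; rewrite eq_le measure_ge0 andbT leNgt; apply/negP; exact: m0.
have [[|k] mk kmin] := ex_minnP (ex_intro (fun k => (0 < m k)%E) _ mk0).
  by rewrite /m mulr0n set_itvco0 setI0 measure0 ltxx in mk.
have [n en] : exists n, e n = d *+ k.+1.
  by apply: e_surj; [exact: natmul_closed|rewrite pmulrn_lgt0].
exists (A `\` [set f : cut e | f n]).
have muB : mu (A `\` [set f : cut e | f n]) = m k.+1 by rewrite cut_measureD_below en.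
split.
- by apply: measurableD => //; exact: below_measurable.
- exact: subDsetl.
- by rewrite muB.
- rewrite muB; apply: le_lt_trans dA.
  have dk : d *+ k <= d *+ k.+1 by rewrite mulrSr lerDl ltW.
  have dk0 : 0 <= d *+ k by rewrite mulrn_wge0// ltW.
  rewrite /m (lebesgueI_itv_split dk0 dk); [|exact: measurableI..].
  have -> : lambda (real_cut e @^-1` A `&` `[0, d *+ k[) = 0%E.
    apply/eqP; rewrite eq_le measure_ge0 andbT leNgt; apply/negP => /kmin.
    by rewrite ltnn.
  rewrite add0e; apply: (@le_trans _ _ (lambda `[d *+ k, d *+ k.+1[)).
    by apply: le_measure; rewrite ?inE//; exact: measurableI.
  by rewrite lebesgue_itv_co// mulrSr [X in X - _]addrC addrK.
Qed.

(** Past the largest of the first [N] values of [e], all [N] comparisons are true, so membership in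
    [U] no longer changes. *)
Lemma clopen_preimage_determined U : clopen U -> exists N k,
  (forall b, determined_on e N (real_cut e @^-1` U) 0 b) /\
  (forall x, e k <= x -> U (real_cut e (e k)) <-> U (real_cut e x)).
Proof.
move=> /clopen_finitely_determined[N NU].
have [k kN] : exists k, forall n, (n < N)%N -> e n <= e k.
  elim: N {NU} => [|N [k kN]]; first by exists 0%N.
  exists (if e N <= e k then k else N) => n; rewrite ltnS leq_eqVlt.
  move=> /predU1P[->|/kN nk]; first by case: ifPn.
  by case: ifPn => //; rewrite -ltNge => /ltW; exact: le_trans.
exists N, k; split=> [b x y _ _ xyN|x kx]; first exact: NU.
have kxN n : (n < N)%N -> real_cut e (e k) n = real_cut e x n.
  by move=> /kN nk /=; rewrite nk (le_trans nk).
by split; apply: NU => // n /kxN.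
Qed.

(** [U] already has mass [c] in some [[0, e l[]: if it contains the tail from [e k], going further
    than [c] beyond [e k] suffices, and otherwise all its mass lies below [e k]. Then
    [determined_measure] gives the truncation point. *)
Lemma clopen_measure_cut U : clopen U -> forall c, D c ->
  (c%:E <= mu U)%E -> exists W, [/\ clopen W, W `<=` U & mu W = c%:E].
Proof.
move=> cU c Dc cU_le; have [N [k [UN Uk]]] := clopen_preimage_determined cU.
have e0 n : 0 <= e n by exact: ltW.
have [l cl] : exists l, (c%:E <= lambda (real_cut e @^-1` U `&` `[0%R, e l[))%E.
  have [Uek|nUek] := pselect (U (real_cut e (e k))).
    have [l kl] := e_unbounded (e k + c); exists l.
    have ekl : e k <= e l by rewrite (le_trans _ (ltW kl))// lerDl Dge0.
    apply: (@le_trans _ _ (lambda `[e k, e l[)).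
      by rewrite lebesgue_itv_co// lee_fin lerBrDl ltW.
    apply: le_measure; rewrite ?inE//.
      by case: (determined_measure D0 Dge0 Dadd Dsub eD D0 (eD l) (e0 l) (UN (e l))).
    move=> x /=; rewrite !in_itv/= => /andP[kx xl].
    by split; [exact/(Uk _ kx)|rewrite (le_trans _ kx)].
  exists k; apply: le_trans cU_le _; rewrite muE.
  rewrite (_ : _ `&` `[0, +oo[ = real_cut e @^-1` U `&` `[0, e k[)//.
  apply/seteqP; split=> x /=; rewrite !in_itv/= andbT; last by move=> [Ux /andP[->]].
  move=> [Ux ->]; split => //=; rewrite ltNge; apply/negP => kx.
  by apply: nUek; exact/(Uk _ kx).
have [_ [r Dr [lr trunc]]] :=
  determined_measure D0 Dge0 Dadd Dsub eD D0 (eD l) (e0 l) (UN (e l)).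
have [|t [Dt t0 _ lt]] := trunc _ Dc; first by rewrite -lee_fin -lr.
(* The point [0] is not among the [e n]; truncation there leaves the empty set. *)
move: t0; rewrite le_eqVlt => /predU1P[t0|t0].
  exists set0; split => //; first exact: clopen0.
  by rewrite measure0 -lt -t0 set_itvco0 setI0 measure0.
have [n en] := e_surj Dt t0.
exists (U `\` [set f : cut e | f n]); split.
- by apply: clopenD => //; exact: below_clopen.
- exact: subDsetl.
- by rewrite cut_measureD_below en.
Qed.

(** Finite measure forces [U] to avoid the tail from [e k], so its mass is that of a determined set
    on [[0, e k[]. Conversely, each value is carved out of the whole space. *)
Lemma cut_measure_values : clopen_values mu = D.
Proof.
have e0 n : 0 <= e n by exact: ltW.
apply/seteqP; split=> [r [U cU muU]|r Dr].
  have [N [k [UN Uk]]] := clopen_preimage_determined cU.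
  have nUek : ~ U (real_cut e (e k)).
    move=> Uek; have : (lambda `[e k, +oo[ <= mu U)%E.
      rewrite muE; apply: le_measure; rewrite ?inE//.
        apply: measurableI => //; apply: measurable_preimage_real_cut.
        exact: clopen_measurable.
      move=> x /=; rewrite !in_itv/= !andbT => kx.
      by split; [exact/(Uk _ kx)|rewrite (le_trans _ kx)].
    by rewrite lebesgue_measure_itv/= ltry muU.
  have [_ [s Ds [ls _]]] :=
    determined_measure D0 Dge0 Dadd Dsub eD D0 (eD k) (e0 k) (UN (e k)).
  suff -> : r = s by [].
  apply/EFin_inj; rewrite -muU -ls muE; congr (lambda _).
  apply/seteqP; split=> x /=; rewrite !in_itv/= andbT; last by move=> [Ux /andP[->]].
  move=> [Ux ->]; split => //=; rewrite ltNge; apply/negP => kx.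
  by apply: nUek; exact/(Uk _ kx).
have [|W [cW _ muW]] := clopen_measure_cut clopenT Dr.
  by rewrite cut_measureT leey.
by exists W.
Qed.

Lemma cut_measure_good : good_measure mu.
Proof.
move=> U V cU cV UV.
have Ufin : mu U \is a fin_num by rewrite ge0_fin_numE// (lt_le_trans UV)// leey.
have DU : D (fine (mu U)).
  by rewrite -cut_measure_values; exists U => //; rewrite fineK.
rewrite -(fineK Ufin); apply: clopen_measure_cut => //.
by rewrite fineK// ltW.
Qed.

End good_cut_measure.

(** * Realization of a group-like set, and the theorem *)

Lemma group_like_realized (R : realType) (D : set R) : group_like D -> D 0 ->
  exists (X : pmetricType R) (mu : borelMeasure R X),
    [/\ cantor_metric_space X, M0_infty mu, good_measure mu &
        clopen_values mu = D].
Proof.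
move=> Dgrp D0; have [Dadd Dsub] := group_like_closed Dgrp.
have [Dge0' Dcnt Ddense _ _] := Dgrp.
have Dge0 a : D a -> 0 <= a by move=> /Dge0'; rewrite /= in_itv/= andbT.
have dense a b : 0 <= a -> a < b -> exists2 d, D d & a < d < b.
  move=> a0 ab; have mD : closure D ((a + b) / 2).
    apply: Ddense; rewrite /= in_itv/= andbT divr_ge0// addr_ge0//.
    by rewrite (le_trans a0)// ltW.
  have [|d [Dd /= dab]] := mD `]a, b[%classic.
    by apply: near_in_itvoo; rewrite in_itv/= !midf_lt.
  by exists d => //; move: dab; rewrite in_itv.
(* Zero is left out: splitting it would create an isolated cut, the one lying below every point. *)
pose P := [set d | D d /\ 0 < d].
have [e eP] : exists e : nat -> R, range e = P.
  have /pfcard_geP[P0|[e]] : (P #<= [set: nat])%card.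
    by apply: sub_countable Dcnt; apply: subset_card_le => d [].
    have [d Dd /andP[d0 _]] := dense _ _ (lexx 0) ltr01.
    by have : P d by []; rewrite P0.
  by exists e; exact: surj_image_eq.
have eP' n : P (e n) by rewrite -eP; exists n.
have eD n : D (e n) by case: (eP' n).
have e_gt0 n : 0 < e n by case: (eP' n).
have e_surj d : D d -> 0 < d -> exists n, e n = d.
  by move=> Dd d0; have : P d by []; rewrite -eP => -[n _ <-]; exists n.
have e_dense a b : 0 <= a -> a < b -> exists n, a < e n < b.
  move=> a0 ab; have [d Dd /andP[ad db]] := dense _ _ a0 ab.
  have [n en] := e_surj d Dd (le_lt_trans a0 ad).
  by exists n; rewrite en ad.
have [mu muE] := cut_measure_exists e.
exists (cut e), mu; split.
- exact: cut_cantor_like.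
- split; last exact: cut_measure_defective muE.
  split; [exact: cut_measure_full muE|exact: (cut_measure_non_atomic (D := D))|].
  exact: cut_measureT muE.
- exact: (cut_measure_good (D := D)).
- exact: cut_measure_values.
Qed.

Theorem theorem2p15 (R : realType) :
  (forall (X : pmetricType R) (mu : borelMeasure R X),
      cantor_metric_space X -> M0_infty mu -> good_measure mu ->
      group_like (clopen_values mu)) /\
  (forall D : set R, group_like D -> D 0 ->
      exists (X : pmetricType R) (mu : borelMeasure R X),
        [/\ cantor_metric_space X, M0_infty mu, good_measure mu &
            clopen_values mu = D]).
Proof.
split=> [X mu Xcantor mu0 mugood|D]; first exact: clopen_values_group_like.
exact: group_like_realized.
Qed.
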